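(* There exists a finitely generated residually finite group with solvable word problem that is not effectively residually finite.
   Context: A finitely generated group has solvable word problem if there is an algorithm that, given a word on a finite generating set and its inverses, decides whether the word represents the identity element. A finitely generated group $G$ is called effectively residually finite if there is an algorithm that takes a word $w$ on the generators of $G$ (and their inverses) as input and, if $w\neq e$ in $G$, produces a morphism $\varphi$ from $G$ to a finite group $F$ that satisfies $\varphi(w)\neq e$. Here the output is a finite description: the multiplication table of $F$ together with the images in $F$ of the generators of $G$. *)

(* Defs.v *)
From Stdlib Require Cantor.
From HB Require Import structures.
From mathcomp Require Import all_boot all_fingroup.

Set Implicit Arguments.
Unset Strict Implicit.
Unset Printing Implicit Defensive.

Definition npair (x y : nat) : nat := Cantor.to_nat (x, y).

(* Kleene's partial recursive functions, presented as unary partial functions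
   on nat, with tuples of arguments passed through the Cantor pairing (a
   bijection nat * nat -> nat).  The identity is PPair PFst PSnd. *)
Inductive prog : Type :=
  | PZero
  | PSucc
  | PFst
  | PSnd
  | PPair of prog & prog
  | PComp of prog & prog
  | PRec of prog & prog
  | PMu of prog.

(* Graph of h given by h(a, 0) = f(a) and h(a, n+1) = g(a, (n, h(a, n))). *)
Fixpoint primrec_graph (f g : nat -> nat -> Prop) (a n y : nat) : Prop :=
  if n is m.+1 then
    exists z, primrec_graph f g a m z /\ g (npair a (npair m z)) y
  else f a y.

(* [computes p x y]: the program p halts on input x with output y.
   For PMu f, the values f(x, 0), ..., f(x, y-1) must be defined and nonzero. *)
Fixpoint computes (p : prog) (x y : nat) : Prop :=
  match p with
  | PZero => y = 0
  | PSucc => y = x.+1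
  | PFst => y = (Cantor.of_nat x).1
  | PSnd => y = (Cantor.of_nat x).2
  | PPair f g => exists u v, [/\ computes f x u, computes g x v & y = npair u v]
  | PComp f g => exists2 z, computes g x z & computes f z y
  | PRec f g => primrec_graph (computes f) (computes g)
                  (Cantor.of_nat x).1 (Cantor.of_nat x).2 y
  | PMu f => computes f (npair x y) 0 /\
             (forall m, m < y -> exists v, computes f (npair x m) v.+1)
  end.

Fixpoint code_seq (s : seq nat) : nat :=
  if s is x :: s' then (npair x (code_seq s')).+1 else 0.

(* The letter (i, false) is the i-th generator, (i, true) is its inverse. *)
Definition word (n : nat) : Type := seq ('I_n * bool).

Definition code_word (n : nat) (w : word n) : nat :=
  code_seq [seq npair l.1 l.2 | l : 'I_n * bool <- w].

Definition eval_word (G : groupType) (n : nat) (gs : n.-tuple G) (w : word n) : G :=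
  (\prod_(l <- w) (if l.2 then (tnth gs l.1)^-1 else tnth gs l.1))%g.

Definition generates (G : groupType) (n : nat) (gs : n.-tuple G) : Prop :=
  forall x : G, exists w : word n, eval_word gs w = x.

Definition finitely_generated (G : groupType) : Prop :=
  exists (n : nat) (gs : n.-tuple G), generates gs.

Definition residually_finite (G : groupType) : Prop :=
  forall x : G, x <> 1%g ->
  exists (F : finGroupType) (phi : {multiplicative G -> F}), phi x <> 1%g.

Definition decides_word_problem (G : groupType) (n : nat) (gs : n.-tuple G)
    (p : prog) : Prop :=
  forall w : word n,
    computes p (code_word w) (if eval_word gs w == 1%g then 1 else 0).

(* Solvability does not depend on the finite generating family, so asking for
   one family is the same as asking for all of them. *)
Definition solvable_word_problem (G : groupType) : Prop :=
  exists (n : nat) (gs : n.-tuple G),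
    generates gs /\ exists p : prog, decides_word_problem gs p.

(* s is a listing of F; elements of F are named by their position in s. *)
Definition mul_table (F : finGroupType) (s : seq F) : seq (seq nat) :=
  [seq [seq index (x * y)%g s | y <- s] | x <- s].

Definition gen_images (G : groupType) (n : nat) (gs : n.-tuple G)
    (F : finGroupType) (phi : G -> F) (s : seq F) : seq nat :=
  [seq index (phi g) s | g <- gs].

Definition code_description (T : seq (seq nat)) (im : seq nat) : nat :=
  npair (code_seq [seq code_seq r | r <- T]) (code_seq im).

Definition describes_morphism (G : groupType) (n : nat) (gs : n.-tuple G)
    (F : finGroupType) (phi : {multiplicative G -> F}) (d : nat) : Prop :=
  exists2 s : seq F, perm_eq s (enum F) &
    d = code_description (mul_table s) (gen_images gs phi s).

(* No requirement is put on p when the input word is trivial in G: it may then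
   diverge or output anything. *)
Definition effectively_separates (G : groupType) (n : nat) (gs : n.-tuple G)
    (p : prog) : Prop :=
  forall w : word n, eval_word gs w <> 1%g ->
  exists (d : nat) (F : finGroupType) (phi : {multiplicative G -> F}),
    [/\ computes p (code_word w) d,
        describes_morphism gs phi d &
        phi (eval_word gs w) <> 1%g].

(* As for the word problem, the choice of the generating family is immaterial. *)
Definition effectively_residually_finite (G : groupType) : Prop :=
  exists (n : nat) (gs : n.-tuple G),
    generates gs /\ exists p : prog, effectively_separates gs p.

(* Main.v *)
From Stdlib Require Cantor.
From HB Require Import structures.
Require Import Defs.
From mathcomp Require Import all_boot all_fingroup.
From mathcomp Require Import cyclic boolp zify.

Set Implicit Arguments.
Unset Strict Implicit.
Unset Printing Implicit Defensive.

(** For a set A of naturals, let t, a, b act on Z/m x {0,1}^2 by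
    t (p, u, v) = (p + 1, u, v), a (p, u, v) = (p, u + [p = x], v) and
    b (p, u, v) = (p, u, v + u [p = y]).  Let G be the subgroup generated by
    (t, a, b) in the product of these finite permutation groups over all
    (m, x, y) such that no n in A satisfies n + x = y mod m; it is residually
    finite.  Since a and b generate a group of class two, the action of a word
    is governed by parities that are bilinear in the two sets of positions where
    a and b are felt.  Hence, if A is closed in the profinite topology of Z, a
    word is trivial in G iff it acts trivially on Z x {0,1}^2 for all x, y in Z
    with y - x not in A, and only a bounded range of x and y matters: G has
    solvable word problem as soon as A is decidable.  The commutator c_d of a
    and t^d b t^-d is trivial exactly when d belongs to A.

    Now A consists of 0 and of the numbers 2^e (1 + 2 (s + 1) D!) such that the
    e-th program halts on input e in exactly s steps with output D.  It is
    decidable, and closed because it has at most one element of each 2-adic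
    valuation.  An algorithm separating elements of G yields a program that
    sends e to an upper bound D for the order of a finite group F and of a
    morphism G -> F that does not kill c_d, d = 2^e.  When e is the code of this
    very program, the number d' = 2^e (1 + 2 (s + 1) D!) is in A and t^d, t^d'
    have the same image in F, so c_d has the same image as c_d' = 1. *)

(** * Subdirect products of finite groups *)

Section EvalWord.
Variables (G : groupType) (n : nat) (gs : n.-tuple G).
Local Open Scope group_scope.

Definition eval_letter (l : 'I_n * bool) : G :=
  if l.2 then (tnth gs l.1)^-1 else tnth gs l.1.

Lemma eval_word_nil : eval_word gs [::] = 1.
Proof. by rewrite /eval_word big_nil. Qed.

Lemma eval_word_cons l w : eval_word gs (l :: w) = eval_letter l * eval_word gs w.
Proof. by rewrite /eval_word big_cons. Qed.

Lemma eval_word_cat w1 w2 :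
  eval_word gs (w1 ++ w2) = eval_word gs w1 * eval_word gs w2.
Proof. by rewrite /eval_word big_cat. Qed.

Lemma eval_word_iter k w1 w2 :
  eval_word gs (iter k (cat w1) w2) = eval_word gs w1 ^+ k * eval_word gs w2.
Proof.
elim: k => [|k IHk]; first by rewrite mul1g.
by rewrite iterS eval_word_cat IHk expgS mulgA.
Qed.

Definition word_inv (w : word n) : word n := rev [seq (l.1, ~~ l.2) | l <- w].

Lemma eval_word_inv w : eval_word gs (word_inv w) = (eval_word gs w)^-1.
Proof.
elim: w => [|l w IHw]; first by rewrite eval_word_nil invg1.
rewrite /word_inv /= rev_cons -cats1 eval_word_cat IHw !eval_word_cons.
rewrite eval_word_nil mulg1 invgM /eval_letter.
by case: l => i [] /=; rewrite ?invgK.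
Qed.

End EvalWord.

Section GroupMorphism.
Variables (G H : groupType) (phi : {multiplicative G -> H}).
Local Open Scope group_scope.

Lemma group_morph1 : phi 1 = 1.
Proof. by apply: (mulgI (phi 1)); rewrite -gmulfM !mulg1. Qed.

Lemma group_morphV x : phi x^-1 = (phi x)^-1.
Proof. by apply: (mulgI (phi x)); rewrite -gmulfM !mulgV group_morph1. Qed.

Lemma group_morphX x k : phi (x ^+ k) = phi x ^+ k.
Proof.
by elim: k => [|k IHk]; rewrite ?group_morph1 // !expgS gmulfM IHk.
Qed.

End GroupMorphism.

Lemma eval_word_morph (G H : groupType) (phi : {multiplicative G -> H}) n
    (gs : n.-tuple G) (hs : n.-tuple H) :
  (forall i, tnth hs i = phi (tnth gs i)) ->
  forall w, eval_word hs w = phi (eval_word gs w).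
Proof.
move=> hsE; elim=> [|l w IHw]; first by rewrite !eval_word_nil group_morph1.
rewrite !eval_word_cons gmulfM IHw; congr (_ * _)%g.
by rewrite /eval_letter hsE; case: l.2; rewrite ?group_morphV.
Qed.

Section Subdirect.
Variables (I : Type) (F : I -> finGroupType) (n : nat).
Variable gens : forall i, n.-tuple (F i).
Local Open Scope group_scope.

(** The subgroup of the product generated by the tuples [gens]. The word is only asserted to exist,
    so that an element is determined by its coordinates. *)
Record subdirect := Subdirect {
  coord : forall i, F i;
  coordP : exists w : word n, forall i, coord i = eval_word (gens i) w
}.

Lemma subdirect_ext x y : (forall i, coord x i = coord y i) -> x = y.
Proof.
case: x y => [f fP] [g gP] /= fg.
have {}fg : f = g by apply: functional_extensionality_dep.
by case: g / fg in gP *; congr Subdirect; apply: Prop_irrelevance.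
Qed.

Definition subdirect_word (w : word n) : subdirect :=
  Subdirect (ex_intro _ w (fun i => erefl (eval_word (gens i) w))).

Lemma subdirect_mulP (x y : subdirect) :
  exists w : word n, forall i, coord x i * coord y i = eval_word (gens i) w.
Proof.
have [[u xE] [v yE]] := (coordP x, coordP y).
by exists (u ++ v) => i; rewrite eval_word_cat xE yE.
Qed.

Lemma subdirect_invP (x : subdirect) :
  exists w : word n, forall i, (coord x i)^-1 = eval_word (gens i) w.
Proof.
have [u xE] := coordP x.
by exists (word_inv u) => i; rewrite eval_word_inv xE.
Qed.

Definition subdirect_mul x y := Subdirect (subdirect_mulP x y).
Definition subdirect_inv x := Subdirect (subdirect_invP x).
Definition subdirect_one := subdirect_word [::].

Lemma subdirect_mulA : associative subdirect_mul.
Proof. by move=> x y z; apply: subdirect_ext => i /=; rewrite mulgA. Qed.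

Lemma subdirect_mul1 : left_id subdirect_one subdirect_mul.
Proof.
by move=> x; apply: subdirect_ext => i /=; rewrite eval_word_nil mul1g.
Qed.

Lemma subdirect_mulr1 : right_id subdirect_one subdirect_mul.
Proof.
by move=> x; apply: subdirect_ext => i /=; rewrite eval_word_nil mulg1.
Qed.

Lemma subdirect_mulV : left_inverse subdirect_one subdirect_inv subdirect_mul.
Proof.
by move=> x; apply: subdirect_ext => i /=; rewrite eval_word_nil mulVg.
Qed.

Lemma subdirect_mulrV : right_inverse subdirect_one subdirect_inv subdirect_mul.
Proof.
by move=> x; apply: subdirect_ext => i /=; rewrite eval_word_nil mulgV.
Qed.

(** The index type may be infinite, so equality and choice are taken classically. *)
HB.instance Definition _ := gen_eqMixin subdirect.
HB.instance Definition _ := gen_choiceMixin subdirect.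
HB.instance Definition _ := isGroup.Build subdirect
  subdirect_mulA subdirect_mul1 subdirect_mulr1 subdirect_mulV subdirect_mulrV.

Section Coord.
Variable i : I.
Definition coord_at (x : subdirect) : F i := coord x i.
Lemma coord_at_mul : {morph coord_at : x y / x * y}. Proof. by []. Qed.
HB.instance Definition _ := isMultiplicative.Build _ _ coord_at coord_at_mul.
End Coord.

Definition subdirect_gens : n.-tuple subdirect :=
  [tuple subdirect_word [:: (j, false)] | j < n].

Lemma coord_gens i j :
  coord_at i (tnth subdirect_gens j) = tnth (gens i) j.
Proof.
by rewrite tnth_mktuple /coord_at /= eval_word_cons eval_word_nil mulg1.
Qed.

Lemma coord_eval i w :
  coord_at i (eval_word subdirect_gens w) = eval_word (gens i) w.
Proof. by apply/esym/eval_word_morph => j; apply/esym/coord_gens. Qed.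

Lemma subdirect_generates : generates subdirect_gens.
Proof.
move=> x; have [w xE] := coordP x; exists w.
by apply: subdirect_ext => i; rewrite -[LHS]/(coord_at i _) coord_eval.
Qed.

Lemma subdirect_residually_finite : residually_finite subdirect.
Proof.
move=> x x1; have [i xi] : exists i, coord x i <> 1.
  apply: contrapT => noti; apply: x1; apply: subdirect_ext => i.
  rewrite -[RHS]/(coord_at i 1) (group_morph1 (coord_at i)).
  by apply: contrapT => xi; apply: noti; exists i.
by exists (F i), (coord_at i).
Qed.

End Subdirect.

(** * The group of a set of naturals *)

(** Positions are natural numbers: a run from [p] on a word [w] is faithful to
    the action on Z only when [size w <= p], so that [p.-1] never truncates. *)
Definition letter_step (alpha beta : pred nat) (s : nat * bool * bool)
    (l : 'I_3 * bool) : nat * bool * bool :=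
  let: (p, u, v) := s in
  if l.1 == 0 :> nat then (if l.2 then p.-1 else p.+1, u, v)
  else if l.1 == 1 :> nat then (p, u (+) alpha p, v)
  else (p, u, v (+) (u && beta p)).

Definition run (alpha beta : pred nat) (s : nat * bool * bool) (w : word 3) :=
  foldl (letter_step alpha beta) s w.

Fixpoint walk (p : nat) (w : word 3) : nat :=
  if w is l :: w' then
    walk (if l.1 == 0 :> nat then if l.2 then p.-1 else p.+1 else p) w'
  else p.

Fixpoint hits (k : nat) (alpha : pred nat) (p : nat) (w : word 3) : bool :=
  if w is l :: w' then
    ((l.1 == k :> nat) && alpha p) (+)
    hits k alpha (if l.1 == 0 :> nat then if l.2 then p.-1 else p.+1 else p) w'
  else false.

(** Parity of the pairs made of a letter a felt in [alpha] and a later letter b felt in [beta]: the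
    corner entry of the unitriangular matrix behind [runE]. *)
Fixpoint pair_hits (alpha beta : pred nat) (p : nat) (w : word 3) : bool :=
  if w is l :: w' then
    [&& l.1 == 1 :> nat, alpha p & hits 2 beta p w'] (+)
    pair_hits alpha beta
      (if l.1 == 0 :> nat then if l.2 then p.-1 else p.+1 else p) w'
  else false.

(** The row (1, u, v) over F_2 is multiplied by a unitriangular matrix: each b felt in [beta] adds
    to v the initial u plus the earlier hits of a, and this sum splits in two. *)
Lemma runE alpha beta w p u v :
  run alpha beta (p, u, v) w =
  (walk p w, u (+) hits 1 alpha p w,
   v (+) (u && hits 2 beta p w) (+) pair_hits alpha beta p w).
Proof.
elim: w p u v => [|[i e] w IHw] p u v; first by rewrite /= andbF !addbF.
rewrite [LHS]/= [run _ _ _ w in LHS]/run -/(run _ _ _ w).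
case: i => [[|[|[|//]]] i3] /=; rewrite -/(run _ _ _ w) IHw //.
- by congr (_, _, _); [rewrite addbA | case: u; case: (alpha p);
     case: (hits 2); case: v; case: (pair_hits _ _ _)].
- by congr (_, _, _); case: u; case: (beta p);
     case: (hits 2); case: v; case: (pair_hits _ _ _).
Qed.

Lemma run_ext (alpha alpha' beta beta' : pred nat) w p u v :
  (forall i, i <= p + size w -> alpha i = alpha' i) ->
  (forall i, i <= p + size w -> beta i = beta' i) ->
  run alpha beta (p, u, v) w = run alpha' beta' (p, u, v) w.
Proof.
elim: w p u v => [//|[i e] w IHw] p u v /= ea eb.
rewrite /run /= -!/(run _ _ _ w).
case: i => [[|[|[|//]]] i3] /=.
- by apply: IHw => j jp; [apply: ea | apply: eb]; case: e jp => /=; lia.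
- rewrite ea /=; last by lia.
  by apply: IHw => j jp; [apply: ea | apply: eb] => /=; lia.
- rewrite eb /=; last by lia.
  by apply: IHw => j jp; [apply: ea | apply: eb] => /=; lia.
Qed.

Lemma walk_le p w : walk p w <= p + size w.
Proof.
elim: w p => [|[i e] w IHw] p /=; first by lia.
by case: eqP => _; [case: e|]; have := IHw p; have := IHw p.-1; have := IHw p.+1; lia.
Qed.

Lemma hits_far k i p w :
  (i + size w < p) || (p + size w < i) -> hits k (pred1 i) p w = false.
Proof.
elim: w p => [//|[j e] w IHw] p /= far.
rewrite IHw; last by case: eqP => _; case: e; lia.
by rewrite addbF; case: (p =P i) => [|_]; [lia | rewrite andbF].
Qed.

Lemma xor_delta N (alpha : pred nat) n : n < N ->
  \big[addb/false]_(i < N) (alpha i && (n == i)) = alpha n.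
Proof.
move=> nN; rewrite (bigD1 (Ordinal nN)) //= eqxx andbT big1 ?addbF // => i.
by rewrite -val_eqE /= eq_sym => /negPf->; rewrite andbF.
Qed.

(** The walk stays below N, where [alpha] is a sum over F_2 of indicators of points, and [hits] is
    linear in [alpha]. The next two lemmas give the bilinearity of [pair_hits] likewise. *)
Lemma hits_sum k (alpha : pred nat) p w N : p + size w < N ->
  hits k alpha p w = \big[addb/false]_(i < N) (alpha i && hits k (pred1 (i : nat)) p w).
Proof.
elim: w p => [|[j e] w IHw] p /= pN; first by rewrite big1 // => i; rewrite andbF.
under eq_bigr => i _ do rewrite andb_addr andbCA.
rewrite big_split -IHw /=; last by case: eqP => _; case: e; lia.
congr (_ (+) _); case: eqP => _ /=; last by rewrite big1.
by rewrite xor_delta //; lia.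
Qed.

Lemma pair_hits_suml (alpha beta : pred nat) p w N : p + size w < N ->
  pair_hits alpha beta p w =
  \big[addb/false]_(i < N) (alpha i && pair_hits (pred1 (i : nat)) beta p w).
Proof.
elim: w p => [|[j e] w IHw] p /= pN; first by rewrite big1 // => i; rewrite andbF.
under eq_bigr => i _ do rewrite andb_addr andbCA [alpha i && (_ && _)]andbA.
rewrite big_split -IHw /=; last by case: eqP => _; case: e; lia.
congr (_ (+) _); case: eqP => _ /=; last by rewrite big1.
case: (hits _ _ _ _); last by rewrite andbF big1 // => i _; rewrite andbF.
under eq_bigr => i _ do rewrite andbT.
by rewrite xor_delta ?andbT //; lia.
Qed.

Lemma pair_hits_sumr (alpha beta : pred nat) p w N : p + size w < N ->
  pair_hits alpha beta p w =
  \big[addb/false]_(j < N) (beta j && pair_hits alpha (pred1 (j : nat)) p w).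
Proof.
elim: w p => [|[j e] w IHw] p /= pN; first by rewrite big1 // => i; rewrite andbF.
under eq_bigr => i _ do rewrite andb_addr.
rewrite big_split -IHw /=; last by case: eqP => _; case: e; lia.
congr (_ (+) _); case: eqP => _ /=; last by rewrite big1 // => i _; rewrite andbF.
case: (alpha p) => /=; last by rewrite big1 // => i _; rewrite andbF.
by apply: hits_sum; lia.
Qed.

Lemma hits0 k (alpha : pred nat) p w N : p + size w < N ->
  (forall i, i < N -> alpha i -> hits k (pred1 i) p w = false) ->
  hits k alpha p w = false.
Proof.
move=> pN h0; rewrite (hits_sum _ _ pN) big1 // => i _.
by case ai: (alpha i) => //=; apply: h0.
Qed.

Lemma pair_hits0 (alpha beta : pred nat) p w N : p + size w < N ->
  (forall i j, i < N -> j < N -> alpha i -> beta j ->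
     pair_hits (pred1 i) (pred1 j) p w = false) ->
  pair_hits alpha beta p w = false.
Proof.
move=> pN h0; rewrite (pair_hits_suml _ _ pN) big1 // => i _.
case ai: (alpha i) => //=; rewrite (pair_hits_sumr _ _ pN) big1 // => j _.
by case bj: (beta j) => //=; apply: h0.
Qed.

(** * Finite quotients acting on Z/m x {0,1}^2 *)

Section CyclicPerms.
Variable m : nat.
Let T : finType := ('I_m.+1 * bool * bool)%type.

Definition shift_fun (s : T) : T := (ordS s.1.1, s.1.2, s.2).
Definition unshift_fun (s : T) : T := (ord_pred s.1.1, s.1.2, s.2).
Definition flip_fun (x : nat) (s : T) : T :=
  (s.1.1, s.1.2 (+) (s.1.1 == x %[mod m.+1]), s.2).
Definition add_fun (y : nat) (s : T) : T :=
  (s.1, s.2 (+) (s.1.2 && (s.1.1 == y %[mod m.+1]))).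

Lemma shift_funK : cancel shift_fun unshift_fun.
Proof. by move=> [[p u] v]; rewrite /shift_fun /unshift_fun /= ordSK. Qed.
Lemma flip_funK x : involutive (flip_fun x).
Proof. by move=> [[p u] v]; rewrite /flip_fun /= addbK. Qed.
Lemma add_funK y : involutive (add_fun y).
Proof. by move=> [[p u] v]; rewrite /add_fun /= addbK. Qed.

Definition shift_perm : {perm T} := perm (can_inj shift_funK).
Definition flip_perm x : {perm T} := perm (inv_inj (flip_funK x)).
Definition add_perm y : {perm T} := perm (inv_inj (add_funK y)).

Lemma shift_permV s : (shift_perm^-1)%g s = unshift_fun s.
Proof.
apply: (perm_inj (s := shift_perm)); rewrite permKV permE.
by case: s => [[p u] v]; rewrite /shift_fun /unshift_fun /= ord_predK.
Qed.

Lemma flip_permV x : ((flip_perm x)^-1)%g = flip_perm x.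
Proof.
apply/permP => s; apply: (perm_inj (s := flip_perm x)).
by rewrite permKV !permE flip_funK.
Qed.

Lemma add_permV y : ((add_perm y)^-1)%g = add_perm y.
Proof.
apply/permP => s; apply: (perm_inj (s := add_perm y)).
by rewrite permKV !permE add_funK.
Qed.

Definition cyclic_gens x y : 3.-tuple {perm T} :=
  [tuple shift_perm; flip_perm x; add_perm y].

(* The shifts [k] and [k'] let a run from a fixed starting position model the
   action on any residue class. *)
Definition coupled (k k' : nat) (s : T) (s' : nat * bool * bool) : Prop :=
  [/\ s.1.1 + k = s'.1.1 + k' %[mod m.+1], s.1.2 = s'.1.2 & s.2 = s'.2].

Lemma coupled_letter x y k k' s s' l : 0 < s'.1.1 -> coupled k k' s s' ->
  coupled k k' (eval_letter (cyclic_gens x y) l s)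
    (letter_step (fun n => n + k' == x + k %[mod m.+1])
                 (fun n => n + k' == y + k %[mod m.+1]) s' l).
Proof.
case: s => [[p u] v]; case: s' => [[n u'] v'] /= n0 [/= pn <- <-].
have hit z : (p == z %[mod m.+1]) = (n + k' == z + k %[mod m.+1]).
  by rewrite -pn eqn_modDr.
case: l => [[[|[|[|//]]] i3] e]; rewrite /eval_letter /= (tnth_nth 1%g) /=.
- split; rewrite ?[in RHS]/=; case: e => /=; rewrite ?shift_permV ?permE //=.
  (* Adding 1 to both sides removes both predecessors; [n0] ensures that [n.-1] does not
     truncate. *)
  + apply/eqP; rewrite -(eqn_modDr 1) -addnA modnDml.
    rewrite (_ : (p + m.+1).-1 + _ = m.+1 + (p + k)); last by lia.
    by rewrite modnDl (_ : n.-1 + k' + 1 = n + k') ?pn //; lia.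
  + by rewrite modnDml addSn -addn1 -modnDml pn modnDml addn1.
- by rewrite flip_permV if_same permE; split=> //=; rewrite hit.
- by rewrite add_permV if_same permE; split=> //=; rewrite hit.
Qed.

(** A letter lowers the position by at most one, so a start at [size w] or above never truncates. *)
Lemma coupled_run x y k k' w s s' : size w <= s'.1.1 -> coupled k k' s s' ->
  coupled k k' (eval_word (cyclic_gens x y) w s)
    (run (fun n => n + k' == x + k %[mod m.+1])
         (fun n => n + k' == y + k %[mod m.+1]) s' w).
Proof.
elim: w s s' => [|l w IHw] s s' ws' ss'; first by rewrite eval_word_nil perm1.
rewrite eval_word_cons permM; apply: IHw; last first.
  by apply: coupled_letter => //; apply: leq_trans ws'.
case: s' ws' {ss'} => [[n u] v] /=.
by case: eqP => _; [case: l.2 | case: eqP => _] => /=; lia.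
Qed.

End CyclicPerms.

Definition t_idx : 'I_3 := @Ordinal 3 0 isT.
Definition a_idx : 'I_3 := @Ordinal 3 1 isT.
Definition b_idx : 'I_3 := @Ordinal 3 2 isT.

(** For involutions a and b, as here, this is the commutator of a with the conjugate of b by t^d. *)
Definition conj_comm (G : groupType) (t a b : G) (d : nat) : G :=
  (let b' := t ^+ d * (b * (t^-1) ^+ d) in a * (b' * (a * b')))%g.

Lemma conj_comm_morph (G H : groupType) (phi : {multiplicative G -> H}) t a b d :
  phi (conj_comm t a b d) = conj_comm (phi t) (phi a) (phi b) d.
Proof. by rewrite /conj_comm !gmulfM !group_morphX group_morphV. Qed.

Section CyclicComm.
Variables m x y d : nat.

(** The same [p] serves every v, so the shift can be undone after v has been changed. *)
Lemma shift_permX (s : 'I_m.+1 * bool * bool) :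
  exists2 p : 'I_m.+1, p = (s.1.1 + d) %% m.+1 :> nat &
    forall v, (shift_perm m ^+ d)%g (s.1, v) = (p, s.1.2, v).
Proof.
case: s => [[p u] _] /=; elim: d => [|k [q qE IHk]].
  by exists p => [|v]; rewrite ?addn0 ?modn_small // perm1.
exists (ordS q) => [|v]; first by rewrite /= qE -addn1 modnDml addn1 addnS.
by rewrite expgSr permM IHk permE.
Qed.

Lemma conj_comm_permE p u v :
  conj_comm (shift_perm m) (flip_perm m x) (add_perm m y) d (p, u, v) =
  (p, u, v (+) ((p == x %[mod m.+1]) && (p + d == y %[mod m.+1]))).
Proof.
have conjE w z : (shift_perm m ^+ d * (add_perm m y * (shift_perm m)^-1 ^+ d))%g
    (p, w, z) = (p, w, z (+) (w && (p + d == y %[mod m.+1]))).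
  have [q qE tE] := shift_permX (p, w, z).
  rewrite expVgn !permM tE [add_perm m y _]permE /add_fun /= qE modn_mod -tE.
  exact: permK.
move: conjE; rewrite /conj_comm /=; move: (shift_perm m ^+ d * _)%g => b conjE.
rewrite !permM [flip_perm m x (p, u, v)]permE /flip_fun /= conjE.
rewrite [flip_perm m x _]permE /flip_fun /= conjE addbK.
by congr (_, _, _); case: u; case: (p == x %[mod _]); case: (_ == y %[mod _]); case: v.
Qed.

End CyclicComm.

(** * The residually finite group of a set and its trivial words *)

Section ProfiniteDouble.
Variable A : pred nat.

Record avoiding := Avoiding {
  period : nat;
  hit_flip : nat;
  hit_add : nat;
  avoidingP : forall n, A n -> n + hit_flip <> hit_add %[mod period.+1]
}.

Definition cyclic_quotient (i : avoiding) : finGroupType :=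
  {perm 'I_(period i).+1 * bool * bool}.

Definition quotient_gens (i : avoiding) : 3.-tuple (cyclic_quotient i) :=
  cyclic_gens (period i) (hit_flip i) (hit_add i).

Definition lamp_group : groupType := subdirect quotient_gens.

Definition lamp_gens : 3.-tuple lamp_group := subdirect_gens quotient_gens.

(** The pair (x, y) stands for the integer y - x, possibly negative: outside A, it has a residue
    class that misses A. Passing to a multiple makes the modulus as large as wanted, which keeps
    short words from wrapping around. *)
Definition profinitely_closed : Prop :=
  forall x y N, (forall n, A n -> n + x <> y) ->
  exists2 m, N <= m & forall n, A n -> n + x <> y %[mod m.+1].

Lemma lamp_group_triv (g : lamp_group) :
  (forall i s, (coord_at i g : {perm _}) s = s) -> g = 1%g.
Proof.
move=> triv; apply: subdirect_ext => i; apply/permP => s.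
rewrite [LHS]triv -[coord _ i]/(coord_at i (1%g : lamp_group)).
by rewrite (group_morph1 (coord_at i)) perm1.
Qed.

(** From B, a word shorter than B stays within [0, 2B]. The guard says that the integer y - x is not
    in A. *)
Definition returns (w : word 3) (B : nat) : Prop :=
  forall x y u, x < (2 * B).+1 -> y < (2 * B).+1 -> ~~ ((x <= y) && A (y - x)) ->
  run (pred1 x) (pred1 y) (B, u, false) w = (B, u, false).

(** In a quotient, a and b are felt on residue classes, which bilinearity cuts into points. Two
    points of these classes differ by y - x modulo the period, so [avoidingP] keeps their difference
    out of A. *)
Lemma returns_triv w B : size w < B -> returns w B -> eval_word lamp_gens w = 1%g.
Proof.
move=> wB ret; apply: lamp_group_triv => i s; rewrite coord_eval.
have retE x y u : x < (2 * B).+1 -> y < (2 * B).+1 -> ~~ ((x <= y) && A (y - x)) ->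
    [/\ walk B w = B, u (+) hits 1 (pred1 x) B w = u &
        (u && hits 2 (pred1 y) B w) (+) pair_hits (pred1 x) (pred1 y) B w = false].
  by move=> xB yB xy; have := ret x y u xB yB xy; rewrite runE => -[].
have ret_walk : walk B w = B by have [] // := retE 1 0 false; lia.
(* The guard holds whenever y < x. This leaves out x = 0 here and y = 2B in [ret_add], two positions
   that [w] is too short to reach. *)
have ret_flip x : 0 < x < (2 * B).+1 -> hits 1 (pred1 x) B w = false.
  by move=> xB; have [] // := retE x 0 false; lia.
have ret_pair x y : x < (2 * B).+1 -> y < (2 * B).+1 -> ~~ ((x <= y) && A (y - x)) ->
    pair_hits (pred1 x) (pred1 y) B w = false.
  by move=> xB yB xy; have [] := retE x y false xB yB xy.
have ret_add y : y < 2 * B -> hits 2 (pred1 y) B w = false.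
  move=> yB; have [|||_ _] := retE (2 * B) y true; try lia.
  by rewrite ret_pair ?addbF; lia.
case: i s => m x y avoid [[p u] v].
change ((eval_word (cyclic_gens m x y) w : {perm _}) (p, u, v) = (p, u, v)).
(* The shifts B and p let the run start at B while the permutation acts from p. *)
have [] := @coupled_run m x y B p w (p, u, v) (B, u, v).
- by rewrite /=; lia.
- by split; rewrite //= addnC.
set al := (fun n => n + p == x + B %[mod m.+1]).
set be := (fun n => n + p == y + B %[mod m.+1]).
have BN : B + size w < (2 * B).+1 by lia.
rewrite runE ret_walk (hits0 (k := 1) (alpha := al) BN); last first.
  case=> [|j] jB _; last by apply: ret_flip; lia.
  by apply: hits_far; lia.
rewrite (hits0 (k := 2) (alpha := be) BN); last first.
  move=> j jB _; have [jB'|jB'] := ltnP j (2 * B); first exact: ret_add.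
  by apply: hits_far; lia.
rewrite (pair_hits0 (alpha := al) (beta := be) BN); last first.
  move=> j1 j2 j1B j2B /eqP a1 /eqP b2; apply: ret_pair => //.
  apply/negP => /andP[j12 Aj]; apply: (avoid _ Aj) => /=.
  apply/eqP; rewrite -(eqn_modDr B) -addnA -modnDmr -a1 modnDmr addnA subnK //.
  exact/eqP.
rewrite [_ && false]andbF !addbF /=.
case: (fun_of_perm _ _) => [[p' u'] v'] /=.
rewrite [B + p]addnC => /eqP; rewrite eqn_modDr !modn_small // => /eqP p'E -> ->.
by congr (_, _, _); apply: val_inj.
Qed.

(** Some quotient has modulus above 2B; there the residue classes of x and y meet [0, 2B] in one
    point each, so the finite action agrees with the run. *)
Lemma triv_returns w B : profinitely_closed -> size w < B ->
  eval_word lamp_gens w = 1%g -> returns w B.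
Proof.
move=> closedA wB w1 x y u xB yB xy.
have [|m mB avoid] := closedA x y (2 * B).
  by move=> n An nxy; case/negP: xy; rewrite -nxy leq_addl addnK.
have := @coupled_run m x y 0 0 w (inord B, u, false) (B, u, false).
have -> : eval_word (cyclic_gens m x y) w = 1%g.
  rewrite -[LHS](coord_eval quotient_gens (Avoiding avoid)) -/lamp_gens w1.
  exact: (group_morph1 (coord_at (Avoiding avoid))).
rewrite perm1 => /(_ (ltnW wB)) []; first by split; rewrite //= inordK //; lia.
have ext z n : z < (2 * B).+1 -> n <= B + size w ->
    (n + 0 == z + 0 %[mod m.+1]) = pred1 z n.
  by move=> zB nB; rewrite !addn0 !modn_small //; lia.
rewrite (run_ext (alpha' := pred1 x) (beta' := pred1 y)) /=; last 2 first.
- by move=> i iB; apply: ext.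
- by move=> i iB; apply: ext.
rewrite inordK; last by lia.
rewrite runE /= !addn0; have wle := walk_le B w.
by rewrite !modn_small; [move=> <- <- <- | lia | lia].
Qed.

Local Open Scope group_scope.

Definition lamp_comm (d : nat) : lamp_group :=
  conj_comm (tnth lamp_gens t_idx) (tnth lamp_gens a_idx) (tnth lamp_gens b_idx) d.

Lemma lamp_commE i d p u v :
  (coord_at i (lamp_comm d) : {perm _}) (p, u, v) =
  (p, u, v (+) ((p == hit_flip i %[mod (period i).+1])
             && (p + d == hit_add i %[mod (period i).+1]))).
Proof.
rewrite -conj_comm_permE; apply: (congr1 (fun g : {perm _} => g (p, u, v))).
rewrite [LHS](conj_comm_morph (coord_at i)).
by congr conj_comm; rewrite [LHS](coord_gens quotient_gens) (tnth_nth 1).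
Qed.

Lemma lamp_comm_triv d : A d -> lamp_comm d = 1.
Proof.
move=> Ad; apply: lamp_group_triv => i [[p u] v]; rewrite lamp_commE.
case: eqP => [px|_]; last by rewrite addbF.
case: eqP => [py|_]; last by rewrite addbF.
by case: (@avoidingP i d Ad); rewrite addnC -modnDml -px modnDml.
Qed.

Lemma lamp_comm_nontriv d : profinitely_closed -> ~~ A d -> lamp_comm d <> 1.
Proof.
(* With a felt at 0 and b felt at d, the commutator changes the last bit of (0, 0, 0). *)
move=> closedA nAd cd1; have [|m _ avoid] := closedA 0 d 0.
  by move=> n An nd; case/negP: nAd; rewrite -nd addn0.
have := @lamp_commE (Avoiding avoid) d ord0 false false.
by rewrite cd1 (group_morph1 (coord_at _)) perm1 /= !eqxx.
Qed.

End ProfiniteDouble.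

(** * Computable functions and an abstract machine *)

Definition fst_code (x : nat) : nat := (Cantor.of_nat x).1.
Definition snd_code (x : nat) : nat := (Cantor.of_nat x).2.

Lemma fst_npair x y : fst_code (npair x y) = x.
Proof. by rewrite /fst_code /npair Cantor.cancel_of_to. Qed.

Lemma snd_npair x y : snd_code (npair x y) = y.
Proof. by rewrite /snd_code /npair Cantor.cancel_of_to. Qed.

Definition npairK := (fst_npair, snd_npair).

Lemma npair_ge x y : y + x <= npair x y.
Proof. by have /leP := Cantor.to_nat_non_decreasing x y. Qed.

Definition computable (f : nat -> nat) : Prop :=
  exists p, forall x, computes p x (f x).

Lemma computable_id : computable (fun x => x).
Proof.
exists (PPair PFst PSnd) => x; exists (fst_code x), (snd_code x); split=> //.
by rewrite /npair -surjective_pairing Cantor.cancel_to_of.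
Qed.

Lemma computable_comp f g :
  computable f -> computable g -> computable (fun x => f (g x)).
Proof. by move=> [p pf] [q qg]; exists (PComp p q) => x; exists (g x). Qed.

Lemma computable_fst f : computable f -> computable (fun x => fst_code (f x)).
Proof. by apply: (@computable_comp fst_code); exists PFst. Qed.

Lemma computable_snd f : computable f -> computable (fun x => snd_code (f x)).
Proof. by apply: (@computable_comp snd_code); exists PSnd. Qed.

Lemma computable_succ f : computable f -> computable (fun x => (f x).+1).
Proof. by apply: (@computable_comp succn); exists PSucc. Qed.

Lemma computable_const c : computable (fun=> c).
Proof. by elim: c => [|c]; [exists PZero | apply: computable_succ]. Qed.

Lemma computable_npair f g :
  computable f -> computable g -> computable (fun x => npair (f x) (g x)).
Proof.
by move=> [p pf] [q qg]; exists (PPair p q) => x; exists (f x), (g x).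
Qed.

(** [PRec] carries x as the parameter of the loop, and composition supplies the bound [n x].
    Iterations, conditionals and bounded searches below all come from this. *)
Lemma computable_rec f g n : computable f ->
  computable (fun z => g (fst_code z) (fst_code (snd_code z)) (snd_code (snd_code z))) ->
  computable n ->
  computable (fun x => nat_rect (fun=> nat) (f x) (g x) (n x)).
Proof.
move=> [p pf] [q qg] cn.
pose h z := nat_rect (fun=> nat) (f (fst_code z)) (g (fst_code z)) (snd_code z).
have ch : computable h.
  exists (PRec p q) => z; rewrite /= -/(fst_code z) -/(snd_code z) /h.
  elim: (snd_code z) => [|k IHk] /=; first exact: pf.
  exists (nat_rect (fun=> nat) (f (fst_code z)) (g (fst_code z)) k); split=> //.
  by have := qg (npair (fst_code z) (npair k
    (nat_rect (fun=> nat) (f (fst_code z)) (g (fst_code z)) k))); rewrite !npairK.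
have := computable_comp ch (computable_npair computable_id cn).
by congr computable; apply: funext => x; rewrite /h !npairK.
Qed.

Lemma computable_iter st f n : computable f ->
  computable (fun z => st (fst_code z) (snd_code z)) ->
  computable n -> computable (fun x => iter (n x) (st x) (f x)).
Proof.
move=> cf cst cn.
apply: (@computable_rec f (fun x _ r => st x r) n) => //.
have := computable_comp cst (computable_npair (computable_fst computable_id)
  (computable_snd (computable_snd computable_id))).
by congr computable; apply: funext => z; rewrite !npairK.
Qed.

Lemma computable_pred f : computable f -> computable (fun x => (f x).-1).
Proof.
apply: (@computable_comp predn).
have := @computable_rec (fun=> 0) (fun _ i _ => i) id (computable_const 0)
  (computable_fst (computable_snd computable_id)) computable_id.
by congr computable; apply: funext => -[].
Qed.

Lemma computable_add f g :
  computable f -> computable g -> computable (fun x => f x + g x).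
Proof.
move=> cf cg; have := @computable_iter (fun=> succn) f g cf
  (computable_succ (computable_snd computable_id)) cg.
by congr computable; apply: funext => x; rewrite iter_succn addnC.
Qed.

Lemma computable_sub f g :
  computable f -> computable g -> computable (fun x => f x - g x).
Proof.
move=> cf cg; have := @computable_iter (fun=> predn) f g cf
  (computable_pred (computable_snd computable_id)) cg.
congr computable; apply: funext => x.
by elim: (g x) => [|k IHk]; rewrite ?subn0 //= IHk subnS.
Qed.

Lemma computable_mul f g :
  computable f -> computable g -> computable (fun x => f x * g x).
Proof.
move=> cf cg; have cst : computable (fun z => f (fst_code z) + snd_code z).
  exact: computable_add (computable_comp cf (computable_fst computable_id))
    (computable_snd computable_id).
have := @computable_iter (fun x => addn (f x)) (fun=> 0) g (computable_const 0) cst cg.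
by congr computable; apply: funext => x; rewrite iter_addn_0.
Qed.

Lemma computable_exp2 f : computable f -> computable (fun x => 2 ^ f x).
Proof.
move=> cf; have := @computable_iter (fun _ r => 2 * r) (fun=> 1) f
  (computable_const 1)
  (computable_mul (computable_const 2) (computable_snd computable_id)) cf.
congr computable; apply: funext => x.
by elim: (f x) => //= k ->; rewrite expnS.
Qed.

Lemma computable_fact f : computable f -> computable (fun x => (f x)`!).
Proof.
move=> cf; have := @computable_rec (fun=> 1) (fun _ i r => i.+1 * r) f
  (computable_const 1)
  (computable_mul (computable_succ (computable_fst (computable_snd computable_id)))
     (computable_snd (computable_snd computable_id))) cf.
congr computable; apply: funext => x.
by elim: (f x) => //= k ->; rewrite factS.
Qed.

(** Booleans count as 0 or 1, and the test is a recursion of at most one round. *)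
Lemma computable_if (b : nat -> bool) f g :
  computable b -> computable f -> computable g ->
  computable (fun x => if b x then f x else g x).
Proof.
move=> cb cf cg; have := @computable_rec g (fun x _ _ => f x) b cg
  (computable_comp cf (computable_fst computable_id)) cb.
by congr computable; apply: funext => x; case: (b x).
Qed.

Lemma computable_neg (b : nat -> bool) : computable b -> computable (fun x => ~~ b x).
Proof.
move=> cb; have := computable_if cb (computable_const 0) (computable_const 1).
by congr computable; apply: funext => x; case: (b x).
Qed.

Lemma computable_and (b c : nat -> bool) :
  computable b -> computable c -> computable (fun x => b x && c x).
Proof.
move=> cb cc; have := computable_if cb cc (computable_const 0).
by congr computable; apply: funext => x; case: (b x).
Qed.

Lemma computable_or (b c : nat -> bool) :
  computable b -> computable c -> computable (fun x => b x || c x).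
Proof.
move=> cb cc; have := computable_if cb (computable_const 1) cc.
by congr computable; apply: funext => x; case: (b x).
Qed.

Lemma computable_eq0 f : computable f -> computable (fun x => f x == 0).
Proof.
move=> cf; have := computable_sub (computable_const 1) cf.
by congr computable; apply: funext => x; case: (f x).
Qed.

Lemma computable_leq f g :
  computable f -> computable g -> computable (fun x => f x <= g x).
Proof.
move=> cf cg; have := computable_eq0 (computable_sub cf cg).
by congr computable.
Qed.

Lemma computable_eq f g :
  computable f -> computable g -> computable (fun x => f x == g x).
Proof.
move=> cf cg; have := computable_and (computable_leq cf cg) (computable_leq cg cf).
by congr computable; apply: funext => x; rewrite eqn_leq.
Qed.

Lemma computable_has (P : nat -> nat -> bool) n :
  computable (fun z => P (fst_code z) (snd_code z)) -> computable n ->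
  computable (fun x => has (P x) (iota 0 (n x))).
Proof.
move=> cP cn.
have cst : computable (fun z => if snd_code (snd_code z) == 1 then 1 else
    P (fst_code z) (fst_code (snd_code z))).
  apply: computable_if; last 2 first.
  - exact: computable_const.
  - have := computable_comp cP (computable_npair (computable_fst computable_id)
      (computable_fst (computable_snd computable_id))).
    by congr computable; apply: funext => z; rewrite !npairK.
  apply: computable_eq; last exact: computable_const.
  exact/computable_snd/computable_snd/computable_id.
have := @computable_rec (fun=> 0) (fun x i r => if r == 1 then 1 else P x i) n
  (computable_const 0) cst cn.
congr computable; apply: funext => x.
elim: (n x) => [//|k IHk]; rewrite [LHS]/= IHk -[in RHS]addn1 iotaD has_cat /= orbF add0n.
by case: (has _ _); case: (P x k).
Qed.

Lemma computable_all (P : nat -> nat -> bool) n :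
  computable (fun z => P (fst_code z) (snd_code z)) -> computable n ->
  computable (fun x => all (P x) (iota 0 (n x))).
Proof.
move=> cP cn; have := computable_neg
  (@computable_has (fun x i => ~~ P x i) n (computable_neg cP) cn).
by congr computable; apply: funext => x; rewrite has_predC negbK.
Qed.

Ltac computability :=
  repeat lazymatch goal with
  | |- computable (fun x => x) => exact: computable_id
  | |- computable fst_code => exact: (computable_fst computable_id)
  | |- computable snd_code => exact: (computable_snd computable_id)
  | |- computable (fun _ => ?c) => exact: (computable_const c)
  | |- computable (fun x => fst_code (@?f x)) => apply: (computable_fst (f := f))
  | |- computable (fun x => snd_code (@?f x)) => apply: (computable_snd (f := f))
  | |- computable (fun x => succn (@?f x)) => apply: (computable_succ (f := f))
  | |- computable (fun x => predn (@?f x)) => apply: (computable_pred (f := f))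
  | |- computable (fun x => factorial (@?f x)) => apply: (computable_fact (f := f))
  | |- computable (fun x => expn 2 (@?f x)) => apply: (computable_exp2 (f := f))
  | |- computable (fun x => npair (@?f x) (@?g x)) =>
      apply: (computable_npair (f := f) (g := g))
  | |- computable (fun x => addn (@?f x) (@?g x)) =>
      apply: (computable_add (f := f) (g := g))
  | |- computable (fun x => subn (@?f x) (@?g x)) =>
      apply: (computable_sub (f := f) (g := g))
  | |- computable (fun x => muln (@?f x) (@?g x)) =>
      apply: (computable_mul (f := f) (g := g))
  | |- computable (fun x => iter (@?n x) (@?st x) (@?f x)) =>
      apply: (computable_iter (st := st) (f := f) (n := n)); cbv beta
  | |- computable (fun x => if _ then _ else _) => apply: computable_if
  | |- computable (fun x => nat_of_bool (@?f x == @?g x)) =>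
      apply: (computable_eq (f := f) (g := g))
  | |- computable (fun x => nat_of_bool (@?f x <= @?g x)) =>
      apply: (computable_leq (f := f) (g := g))
  | |- computable (fun x => nat_of_bool (~~ @?f x)) =>
      apply: (computable_neg (b := f))
  | |- computable (fun x => nat_of_bool (@?f x && @?g x)) =>
      apply: (computable_and (b := f) (c := g))
  | |- computable (fun x => nat_of_bool (@?f x || @?g x)) =>
      apply: (computable_or (b := f) (c := g))
  | |- computable (fun x => nat_of_bool (has (@?P x) (iota 0 (@?n x)))) =>
      apply: (computable_has (P := P) (n := n)); cbv beta
  | |- computable (fun x => nat_of_bool (all (@?P x) (iota 0 (@?n x)))) =>
      apply: (computable_all (P := P) (n := n)); cbv beta
  end.

(** * Codes of programs and their step-by-step execution *)

Fixpoint prog_code (p : prog) : nat :=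
  match p with
  | PZero => npair 0 0
  | PSucc => npair 1 0
  | PFst => npair 2 0
  | PSnd => npair 3 0
  | PPair f g => npair 4 (npair (prog_code f) (prog_code g))
  | PComp f g => npair 5 (npair (prog_code f) (prog_code g))
  | PRec f g => npair 6 (npair (prog_code f) (prog_code g))
  | PMu f => npair 7 (prog_code f)
  end.

Definition eval_conf (p x K : nat) : nat := npair 1 (npair (npair p x) K).
Definition ret_conf (y K : nat) : nat := npair 2 (npair y K).
(* A stack frame [tag, data] tells what to do with the value being returned:
   0, 1: it is the first, resp. second component of a [PPair];
   2: feed it to the outer program of a [PComp];
   3: it is the value of a [PRec] at [i], with [n] more rounds to go;
   4: it is the value at [i] of the program minimised by a [PMu]. *)
Definition push (tag data K : nat) : nat := (npair (npair tag data) K).+1.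

Definition rec_frame (g a i n : nat) : nat := npair g (npair a (npair i n)).
Definition mu_frame (f x i : nat) : nat := npair f (npair x i).

(** Every number is run, whether or not it codes a program: unknown tags fall into the last branch.
    This is harmless, as any computable machine that halts at most once and simulates the programs
    will do. *)
Definition eval_step (tag q x K : nat) : nat :=
  if tag == 0 then ret_conf 0 K
  else if tag == 1 then ret_conf x.+1 K
  else if tag == 2 then ret_conf (fst_code x) K
  else if tag == 3 then ret_conf (snd_code x) K
  else if tag == 4 then
    eval_conf (fst_code q) x (push 0 (npair (snd_code q) x) K)
  else if tag == 5 then eval_conf (snd_code q) x (push 2 (fst_code q) K)
  else if tag == 6 then
    eval_conf (fst_code q) (fst_code x)
      (push 3 (rec_frame (snd_code q) (fst_code x) 0 (snd_code x)) K)
  else eval_conf q (npair x 0) (push 4 (mu_frame q x 0) K).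

Definition ret_rec_step (y g a i n K : nat) : nat :=
  if n == 0 then ret_conf y K
  else eval_conf g (npair a (npair i y)) (push 3 (rec_frame g a i.+1 n.-1) K).

Definition ret_mu_step (y f x i K : nat) : nat :=
  if y == 0 then ret_conf i K
  else eval_conf f (npair x i.+1) (push 4 (mu_frame f x i.+1) K).

Definition ret_step (y tag d K : nat) : nat :=
  if tag == 0 then eval_conf (fst_code d) (snd_code d) (push 1 y K)
  else if tag == 1 then ret_conf (npair d y) K
  else if tag == 2 then eval_conf d y K
  else if tag == 3 then
    ret_rec_step y (fst_code d) (fst_code (snd_code d))
      (fst_code (snd_code (snd_code d))) (snd_code (snd_code (snd_code d))) K
  else
    ret_mu_step y (fst_code d) (fst_code (snd_code d)) (snd_code (snd_code d)) K.

(* A configuration that returns a value to the empty stack steps to the dead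
   configuration 0, so that a run halts at no more than one time. *)
Definition step (c : nat) : nat :=
  if fst_code c == 1 then
    eval_step (fst_code (fst_code (fst_code (snd_code c))))
      (snd_code (fst_code (fst_code (snd_code c))))
      (snd_code (fst_code (snd_code c))) (snd_code (snd_code c))
  else if (fst_code c == 2) && ~~ (snd_code (snd_code c) == 0) then
    ret_step (fst_code (snd_code c))
      (fst_code (fst_code (snd_code (snd_code c)).-1))
      (snd_code (fst_code (snd_code (snd_code c)).-1))
      (snd_code (snd_code (snd_code c)).-1)
  else 0.

Lemma step_eval p x K :
  step (eval_conf p x K) = eval_step (fst_code p) (snd_code p) x K.
Proof. by rewrite /step /eval_conf !npairK. Qed.

Lemma step_ret y tag d K : step (ret_conf y (push tag d K)) = ret_step y tag d K.
Proof. by rewrite /step /ret_conf /push /= !npairK. Qed.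

Definition reaches (c c' : nat) : Prop := exists k, iter k step c = c'.

Lemma reaches_refl c : reaches c c.
Proof. by exists 0. Qed.

Lemma reaches_trans c1 c2 c3 : reaches c1 c2 -> reaches c2 c3 -> reaches c1 c3.
Proof. by move=> [k <-] [l <-]; exists (l + k); rewrite iterD. Qed.

Lemma reaches_step c c' : reaches (step c) c' -> reaches c c'.
Proof. by move=> [k <-]; exists k.+1; rewrite iterSr. Qed.

(** Induction on [p] under an arbitrary stack, since a subprogram runs above the frame that awaits
    its value. *)
Lemma reaches_computes p x y K :
  computes p x y -> reaches (eval_conf (prog_code p) x K) (ret_conf y K).
Proof.
elim: p x y K => [||||f IHf g IHg|f IHf g IHg|f IHf g IHg|f IHf] x y K /=.
- by move=> ->; exists 1; rewrite /= step_eval !npairK.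
- by move=> ->; exists 1; rewrite /= step_eval !npairK.
- by move=> ->; exists 1; rewrite /= step_eval !npairK.
- by move=> ->; exists 1; rewrite /= step_eval !npairK.
- move=> [u [v [fu gv ->]]]; apply: reaches_step.
  rewrite step_eval /eval_step /= !npairK /=.
  apply: reaches_trans (IHf _ _ _ fu) _; apply: reaches_step.
  rewrite step_ret /ret_step /= !npairK.
  apply: reaches_trans (IHg _ _ _ gv) _; apply: reaches_step.
  by rewrite step_ret; apply: reaches_refl.
- move=> [z gz fy]; apply: reaches_step; rewrite step_eval /eval_step /= !npairK /=.
  apply: reaches_trans (IHg _ _ _ gz) _; apply: reaches_step.
  by rewrite step_ret; apply: IHf.
- rewrite -/(fst_code x) -/(snd_code x) => gr; apply: reaches_step.
  rewrite step_eval /eval_step /= !npairK /=.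
  (* Out of n + r rounds, r are left once the value at n is known; the induction moves one round
     from n to r. *)
  have loop n z r : primrec_graph (computes f) (computes g) (fst_code x) n z ->
      reaches (eval_conf (prog_code f) (fst_code x)
                (push 3 (rec_frame (prog_code g) (fst_code x) 0 (n + r)) K))
        (ret_conf z (push 3 (rec_frame (prog_code g) (fst_code x) n r) K)).
    elim: n z r => [|n IHn] z r /=; first exact: IHf.
    move=> [z' [/IHn nz' gz]]; rewrite addSnnS.
    apply: reaches_trans (nz' r.+1) _; apply: reaches_step.
    by rewrite step_ret /ret_step /= /rec_frame !npairK; apply: IHg.
  have := loop _ _ 0 gr; rewrite addn0 => run_f; apply: reaches_trans run_f _.
  apply: reaches_step; rewrite step_ret /ret_step /= /rec_frame !npairK.
  exact: reaches_refl.
- move=> [fy lt]; apply: reaches_step; rewrite step_eval /eval_step /= !npairK /=.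
  have loop m : m <= y -> reaches
      (eval_conf (prog_code f) (npair x 0) (push 4 (mu_frame (prog_code f) x 0) K))
      (eval_conf (prog_code f) (npair x m) (push 4 (mu_frame (prog_code f) x m) K)).
    elim: m => [|m IHm] my; first exact: reaches_refl.
    apply: reaches_trans (IHm (ltnW my)) _; have [v fv] := lt m my.
    apply: reaches_trans (IHf _ _ _ fv) _; apply: reaches_step.
    rewrite step_ret /ret_step /= /mu_frame !npairK; exact: reaches_refl.
  apply: reaches_trans (loop y (leqnn y)) _; apply: reaches_trans (IHf _ _ _ fy) _.
  apply: reaches_step; rewrite step_ret /ret_step /= /mu_frame !npairK.
  exact: reaches_refl.
Qed.

Lemma computable_step : computable step.
Proof.
rewrite /step /eval_step /ret_step /ret_rec_step /ret_mu_step.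
rewrite /eval_conf /ret_conf /push /rec_frame /mu_frame.
by computability.
Qed.

(** * The diagonal set *)

Definition conf (e s : nat) : nat := iter s step (eval_conf e e 0).

Definition halted (c : nat) : bool :=
  (fst_code c == 2) && (snd_code (snd_code c) == 0).

Definition output (c : nat) : nat := fst_code (snd_code c).

(** The 2-adic valuation records e, the factor [s.+1] makes the element exceed s, and the factorial
    makes its difference with 2^e divisible by every positive integer up to the output. *)
Definition diag_elt (e s : nat) : nat :=
  2 ^ e * (2 * (s.+1 * (output (conf e s))`!)).+1.

(** 0 is included as the 2-adic limit of elements of growing valuation. Both searches may stop at x
    by [diag_elt_bounds]. *)
Definition diag : pred nat := fun x =>
  (x == 0) ||
  has (fun e => has (fun s => halted (conf e s) && (x == diag_elt e s))
                  (iota 0 x)) (iota 0 x).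

Lemma halted_step c : halted c -> step c = 0.
Proof. by case/andP => /eqP c2 /eqP c0; rewrite /step c2 c0. Qed.

Lemma halted_uniq e s s' : halted (conf e s) -> halted (conf e s') -> s = s'.
Proof.
have dead t k : halted (conf e t) -> halted (conf e (t + k.+1)) = false.
  move=> ht; rewrite /conf addnC iterD iterSr -/(conf e t) halted_step //.
  by have -> : iter k step 0 = 0 by elim: k => //= k ->.
move=> hs hs'; have [lt|lt|//] := ltngtP s s'.
- by have := dead s (s' - s.+1) hs; rewrite (_ : s + _ = s') ?hs' //; lia.
- by have := dead s' (s - s'.+1) hs'; rewrite (_ : s' + _ = s) ?hs //; lia.
Qed.

Lemma diag_elt_bounds e s : e < diag_elt e s /\ s < diag_elt e s.
Proof.
have e2 : e < 2 ^ e by apply: ltn_expl.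
have f0 := fact_gt0 (output (conf e s)).
split; rewrite /diag_elt; first by apply: leq_trans e2 _; rewrite leq_pmulr.
apply: (@leq_trans (2 * (s.+1 * (output (conf e s))`!)).+1).
  by apply: leq_trans (leq_pmulr s.+1 f0) _; lia.
by rewrite leq_pmull // expn_gt0.
Qed.

Lemma diagP x :
  reflect (x = 0 \/ exists e s, halted (conf e s) /\ x = diag_elt e s) (diag x).
Proof.
apply: (iffP orP) => [[/eqP|/hasP[e _ /hasP[s _ /andP[hs /eqP->]]]]|].
- by left.
- by right; exists e, s.
case=> [->|[e [s [hs ->]]]]; [by left | right].
have [le ls] := diag_elt_bounds e s.
apply/hasP; exists e; first by rewrite mem_iota.
by apply/hasP; exists s; rewrite ?mem_iota // hs eqxx.
Qed.

Lemma computable_diag f : computable f -> computable (fun x => diag (f x)).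
Proof.
apply: (@computable_comp (fun x => nat_of_bool (diag x))).
rewrite /diag /diag_elt /halted /output /conf /eval_conf; computability.
all: exact: computable_comp computable_step (computable_snd computable_id).
Qed.

Lemma diag_elt_gt0 e s : 0 < diag_elt e s.
Proof. by rewrite muln_gt0 expn_gt0. Qed.

Lemma logn_diag_elt e s : logn 2 (diag_elt e s) = e.
Proof.
rewrite lognM ?expn_gt0 // pfactorK // lognE /= dvdn2 /= mul2n odd_double /=.
by rewrite addn0.
Qed.

(** The valuation determines e, and the odd factor in [diag_elt] is at least 3. *)
Lemma diag_exp2 e : ~~ diag (2 ^ e).
Proof.
apply/diagP => -[/eqP|[e' [s [_ eE]]]]; first by rewrite expn_eq0.
have ee' : e = e' by rewrite -(logn_diag_elt e' s) -eE pfactorK.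
have /eqP := eE; rewrite -ee' -[X in X == _]muln1 eqn_pmul2l ?expn_gt0 //.
by have := fact_gt0 (output (conf e s)); rewrite eq_sym; lia.
Qed.

(* One of the two truncated differences is 0: the sum is |x - y|. *)
Lemma dvdn_eqmod q n x y :
  n + x = y %[mod q] -> (q %| n) = (q %| (x - y) + (y - x)).
Proof.
have [xy|/ltnW yx] := leqP x y.
  rewrite (eqP xy) -{1}(subnK xy) => /eqP; rewrite eqn_modDr => /eqP nE.
  by rewrite /dvdn nE.
rewrite (eqP yx) addn0 => nxy; have qn : q %| n + (x - y).
  by rewrite /dvdn -[0](mod0n q) -(eqn_modDr y) -addnA subnK // add0n nxy.
by apply/idP/idP => [qx|qx]; [rewrite -(dvdn_addr _ qx) | rewrite -(dvdn_addl _ qx)].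
Qed.

(** Modulo a large power of 2, a nonzero n congruent to y - x has the same valuation v as y - x. At
    most one element of the set has valuation v, and a modulus large enough for it turns the
    congruence into an equality. *)
Lemma diag_closed : profinitely_closed diag.
Proof.
move=> x y N nxy.
have x_neq_y : x <> y by apply: (nxy 0); apply/diagP; left.
set d := (x - y) + (y - x); have d0 : 0 < d by lia.
set v := logn 2 d.
(* Whether the run of v halts is settled classically: [b] need not be computable from v. *)
have [b bP] : exists b, forall s, halted (conf v s) -> diag_elt v s <= b.
  have [[s hs]|nh] := pselect (exists s, halted (conf v s)).
    by exists (diag_elt v s) => s' /(halted_uniq hs) <-.
  by exists 0 => s hs; case: nh; exists s.
pose M := N + b + x + y + v + 2.
have M2 : M < 2 ^ M by apply: ltn_expl.
have [NM xM yM bM] : [/\ N <= (2 ^ M).-1, x < 2 ^ M, y < 2 ^ M & b + x < 2 ^ M].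
  by rewrite /M in M2 *; split; lia.
exists (2 ^ M).-1 => //.
rewrite prednK ?expn_gt0 // => n /diagP nA nxyM.
case: nA => [n0|[e [s [hs nE]]]].
  by move: nxyM; rewrite n0 add0n !modn_small.
have dvdE k : k <= M -> (2 ^ k %| n) = (2 ^ k %| d).
  move=> kM; apply: dvdn_eqmod; have qM := dvdn_exp2l 2 kM.
  by rewrite -(modn_dvdm _ qM) nxyM modn_dvdm.
have n0 : 0 < n by rewrite nE diag_elt_gt0.
have ev : e = v.
  have vM : v < M by rewrite /M; lia.
  have := dvdE v.+1 vM; have := dvdE v (ltnW vM).
  rewrite !pfactor_dvdn // -/v leqnn ltnn nE logn_diag_elt => ve ev.
  by apply/eqP; rewrite eqn_leq ve leqNgt ev.
apply: (nxy n); first by apply/diagP; right; exists e, s.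
have nb : n <= b by rewrite nE ev bP // -ev.
by move: nxyM; rewrite !modn_small //; lia.
Qed.

(** * Solving the word problem on codes of words *)

Lemma code_word_cons n (l : 'I_n * bool) (w : word n) :
  code_word (l :: w) = (npair (npair l.1 l.2) (code_word w)).+1.
Proof. by []. Qed.

Lemma code_seq_ge s : size s <= code_seq s.
Proof.
elim: s => [//|x s IHs] /=; rewrite ltnS; apply: leq_trans IHs _.
by apply: leq_trans (leq_addr _ _) (npair_ge _ _).
Qed.

Lemma code_word_ge n (w : word n) : size w <= code_word w.
Proof. by rewrite -(size_map (fun l : 'I_n * bool => npair l.1 l.2)) code_seq_ge. Qed.

Definition state_code (s : nat * bool * bool) : nat :=
  npair s.1.1 (npair s.1.2 s.2).

Lemma state_code_inj : injective state_code.
Proof.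
move=> [[p u] v] [[p' u'] v'] /= eq_code.
have := congr1 fst_code eq_code; have := congr1 snd_code eq_code.
rewrite /state_code !npairK /= => eq_uv ->.
have := congr1 fst_code eq_uv; have := congr1 snd_code eq_uv.
by rewrite !npairK; case: u u' v v' {eq_code eq_uv} => -[] [] [].
Qed.

Definition letter_step_code (x y i e p u v : nat) : nat :=
  if i == 0 then npair (if e == 1 then p.-1 else p.+1) (npair u v)
  else if i == 1 then npair p (npair (if p == x then 1 - u else u) v)
  else npair p (npair u (if (u == 1) && (p == y) then 1 - v else v)).

(** The empty word has code 0, on which the step idles: any number of rounds not below the length
    gives the whole run. *)
Definition run_step_code (x y c : nat) : nat :=
  if fst_code c == 0 then c else
  npair (snd_code (fst_code c).-1)
    (letter_step_code x y
       (fst_code (fst_code (fst_code c).-1)) (snd_code (fst_code (fst_code c).-1))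
       (fst_code (snd_code c)) (fst_code (snd_code (snd_code c)))
       (snd_code (snd_code (snd_code c)))).

Lemma letter_step_codeE x y (s : nat * bool * bool) (l : 'I_3 * bool) :
  letter_step_code x y l.1 l.2 s.1.1 s.1.2 s.2 =
  state_code (letter_step (pred1 x) (pred1 y) s l).
Proof.
case: s l => [[p u] v] [[[|[|[|//]]] i3] e];
  rewrite /letter_step_code /state_code /=.
- by case: e.
- by case: (p == x); case: u.
- by case: (p == y); case: u; case: v.
Qed.

Lemma run_step_codeE x y (w : word 3) s k : size w <= k ->
  iter k (run_step_code x y) (npair (code_word w) (state_code s)) =
  npair 0 (state_code (run (pred1 x) (pred1 y) s w)).
Proof.
elim: w s k => [|l w IHw] s k /= wk.
  by elim: k {wk} => //= k ->; rewrite /run_step_code !npairK.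
case: k wk => // k wk; rewrite iterSr.
rewrite -/(run _ _ _ w) -(IHw _ k) //; congr iter.
by rewrite /run_step_code code_word_cons !npairK /= letter_step_codeE.
Qed.

(** A code bounds the length of its word, so [c.+1] serves as the B of [returns] and c rounds read
    all the letters. *)
Definition decide (c : nat) : bool :=
  all (fun x => all (fun y => all (fun u =>
    ((x <= y) && diag (y - x)) ||
    (iter c (run_step_code x y) (npair c (npair c.+1 (npair u 0)))
      == npair 0 (npair c.+1 (npair u 0))))
  (iota 0 2)) (iota 0 (2 * c.+1).+1)) (iota 0 (2 * c.+1).+1).

Lemma computable_decide : computable decide.
Proof.
rewrite /decide /run_step_code /letter_step_code; computability.
by apply: computable_diag; computability.
Qed.

Lemma decideP (w : word 3) :
  decide (code_word w) = (eval_word (lamp_gens diag) w == 1%g).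
Proof.
set c := code_word w.
have wc : size w < c.+1 by rewrite ltnS code_word_ge.
have runE x y (k : nat) (u : bool) : k = u ->
    (iter c (run_step_code x y) (npair c (npair c.+1 (npair k 0)))
      == npair 0 (npair c.+1 (npair k 0))) =
    (run (pred1 x) (pred1 y) (c.+1, u, false) w == (c.+1, u, false)).
  move=> ->.
  rewrite -[npair c.+1 _]/(state_code (c.+1, u, false)) run_step_codeE //.
  apply/eqP/eqP => [eq_code|-> //]; apply: state_code_inj.
  by have := congr1 snd_code eq_code; rewrite !npairK.
apply/idP/eqP => [/allP dec|w1].
  apply: (returns_triv wc) => x y u xB yB xy; apply/eqP; rewrite -(runE x y u) //.
  have lt_iota n i : i < n -> i \in iota 0 n by rewrite mem_iota.
  have /allP decx := dec x (lt_iota _ _ xB).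
  have /allP decy := decx y (lt_iota _ _ yB).
  by have := decy u; rewrite (negPf xy); apply; case: u.
have ret := triv_returns diag_closed wc w1.
apply/allP => x; rewrite mem_iota => xB; apply/allP => y; rewrite mem_iota => yB.
apply/allP => u; have [//|xy] := boolP ((x <= y) && _).
rewrite mem_iota; case: u => [|[|//]] _.
- by rewrite (runE _ _ _ false) // ret ?eqxx.
- by rewrite (runE _ _ _ true) // ret ?eqxx.
Qed.

Lemma lamp_solvable : solvable_word_problem (lamp_group diag).
Proof.
exists 3, (lamp_gens diag); split; first exact: subdirect_generates.
have [p pP] := computable_decide; exists p => w.
by rewrite -decideP; have := pP (code_word w); case: (decide _).
Qed.

(** * Diagonal argument against effective separation *)

Definition prepend n (w : word n) (c : nat) : nat :=
  foldr (fun (l : 'I_n * bool) c' => (npair (npair l.1 l.2) c').+1) c w.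

Lemma code_word_cat n (w1 w2 : word n) :
  code_word (w1 ++ w2) = prepend w1 (code_word w2).
Proof. by elim: w1 => //= l w1 <-. Qed.

Lemma code_word_iter n k (w1 w2 : word n) :
  code_word (iter k (cat w1) w2) = iter k (prepend w1) (code_word w2).
Proof. by elim: k => //= k <-; rewrite code_word_cat. Qed.

Lemma computable_prepend n (w : word n) f :
  computable f -> computable (fun x => prepend w (f x)).
Proof. by move=> cf; elim: w => [//|l w IHw] /=; computability. Qed.

Lemma computable_iter_prepend n (w : word n) f g :
  computable f -> computable g -> computable (fun x => iter (f x) (prepend w) (g x)).
Proof.
move=> cf cg; apply: (@computable_iter (fun=> prepend w)) => //.
by apply: computable_prepend; computability.
Qed.

(** [wb'] takes the tail of the word as argument, so that the code arises from that of the empty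
    word by repeatedly prepending fixed words. *)
Definition conj_comm_word n (wt wt' wa wb : word n) (d : nat) : word n :=
  let wb' w := iter d (cat wt) (wb ++ iter d (cat wt') w) in
  wa ++ wb' (wa ++ wb' [::]).

Lemma eval_conj_comm_word (G : groupType) n (gs : n.-tuple G) wt wt' wa wb d :
  eval_word gs wt' = (eval_word gs wt)^-1%g ->
  eval_word gs (conj_comm_word wt wt' wa wb d) =
  conj_comm (eval_word gs wt) (eval_word gs wa) (eval_word gs wb) d.
Proof.
move=> wt'E; rewrite /conj_comm_word /conj_comm.
rewrite !(eval_word_cat, eval_word_iter) wt'E eval_word_nil mulg1.
by rewrite !mulgA.
Qed.

Lemma computable_conj_comm_word n (wt wt' wa wb : word n) f : computable f ->
  computable (fun x => code_word (conj_comm_word wt wt' wa wb (f x))).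
Proof.
move=> cf; rewrite /conj_comm_word.
under eq_fun => x do rewrite !(code_word_cat, code_word_iter).
do 2!(apply: computable_prepend; apply: computable_iter_prepend => //;
      apply: computable_prepend; apply: computable_iter_prepend => //).
exact: computable_const.
Qed.

Lemma conj_comm_expn (G : groupType) (t a b : G) d d' :
  (t ^+ d = t ^+ d')%g -> conj_comm t a b d = conj_comm t a b d'.
Proof. by rewrite /conj_comm !expVgn => ->. Qed.

(** A list code is at least the length of the list and the table has one row per element, so the
    output itself bounds the order of the quotient. *)
Lemma describes_morphism_card (G : groupType) n (gs : n.-tuple G)
    (F : finGroupType) (phi : {multiplicative G -> F}) d :
  describes_morphism gs phi d -> #|F| <= d.
Proof.
move=> [s sF ->]; have <- : size (mul_table s) = #|F|.
  by rewrite size_map (perm_size sF) -cardE.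
rewrite -(size_map code_seq).
apply: leq_trans (code_seq_ge _) _; apply: leq_trans (leq_addl _ _) (npair_ge _ _).
Qed.

Lemma lamp_not_effective : ~ effectively_residually_finite (lamp_group diag).
Proof.
move=> [n [gs [gen [p sep]]]].
set t := tnth (lamp_gens diag) t_idx.
(* The generating family is arbitrary: t, its inverse, a and b are first spelled in it. *)
have [wt wtE] := gen t; have [wt' wt'E] := gen t^-1%g.
have [wa waE] := gen (tnth (lamp_gens diag) a_idx).
have [wb wbE] := gen (tnth (lamp_gens diag) b_idx).
have commE d : eval_word gs (conj_comm_word wt wt' wa wb d) = lamp_comm diag d.
  by rewrite eval_conj_comm_word ?wt'E wtE // waE wbE.
have [r rP] := computable_conj_comm_word wt wt' wa wb (computable_exp2 computable_id).
(* On input i this program applies the separator to the commutator for 2^i; it is now fed its own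
   code. *)
set e := prog_code (PComp p r).
have [] := sep (conj_comm_word wt wt' wa wb (2 ^ e)).
  by rewrite commE; apply: lamp_comm_nontriv diag_closed (diag_exp2 e).
move=> d [F [phi [pd desc]]]; rewrite commE; apply.
have [s sE] : reaches (eval_conf e e 0) (ret_conf d 0).
  by apply: reaches_computes; exists (code_word (conj_comm_word wt wt' wa wb (2 ^ e))).
have halt : halted (conf e s) by rewrite /conf sE /halted /ret_conf !npairK.
have elt1 : lamp_comm diag (diag_elt e s) = 1%g.
  by apply: lamp_comm_triv; apply/diagP; right; exists e, s.
(* The trivial commutator for [diag_elt e s] has the same image as the one for 2^e, because the two
   exponents of t differ by a multiple of [#|F|]. *)
rewrite -(group_morph1 phi) -elt1 /lamp_comm !conj_comm_morph.
apply: conj_comm_expn; set x := phi _.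
have /dvdnP[k kE] : #|F| %| d`!.
  rewrite dvdn_fact // (describes_morphism_card desc) andbT.
  by apply/card_gt0P; exists 1%g.
have xF : (x ^+ #|F| = 1)%g by rewrite -cardsT expg_cardG ?inE.
rewrite /diag_elt /conf sE /output /ret_conf !npairK kE mulnS.
have -> : 2 ^ e * (2 * (s.+1 * (k * #|F|))) = #|F| * (2 ^ e * (2 * (s.+1 * k))).
  by lia.
by rewrite expgD expgM xF expg1n mulg1.
Qed.

Theorem theorem2 :
  exists G : groupType,
    [/\ finitely_generated G,
        residually_finite G,
        solvable_word_problem G &
        ~ effectively_residually_finite G].
Proof.
exists (lamp_group diag); split.
- by exists 3, (lamp_gens diag); apply: subdirect_generates.
- exact: subdirect_residually_finite.
- exact: lamp_solvable.
- exact: lamp_not_effective.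
Qed.
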